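(* Let $a,b,c>0$ and for $(x,y)\in\overline{\mathbb{R}_+^2}$ let $$\Phi(x,y)=\min_{s\ge0}\left\{\frac{(-x+bs+c)^2}{4(1+as)}+\frac{(y+s)^2}{4}\right\},\qquad \Omega=\{(x,y)\in\overline{\mathbb{R}_+^2}:\ \Phi(x,y)<1\}.$$ Then the function $\Phi$ is convex on its domain $\overline{\mathbb{R}_+^2}$, and the level set $\Omega$ is strictly convex.
   Context: $\overline{\mathbb{R}_+^2}=\mathbb{R}\times[0,\infty)$. Strict convexity of $\Omega$ is meant in the following sense: $\Omega$ is convex and the level curve $\{(x,y)\in\overline{\mathbb{R}_+^2}:\Phi(x,y)=1\}$ contains no non-degenerate line segment. *)

(* Defs.v *)
From mathcomp Require Import all_boot all_order all_algebra.
From mathcomp Require Import ring lra.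
From mathcomp Require Import all_classical all_reals all_analysis.

Set Implicit Arguments.
Unset Strict Implicit.
Unset Printing Implicit Defensive.

Import Order.TTheory GRing.Theory Num.Theory.
Import numFieldNormedType.Exports.

Local Open Scope classical_set_scope.
Local Open Scope ring_scope.
Local Open Scope convex_scope.

(* R^o is R viewed as a module over itself, so that R^o * R^o is the plane
   with its vector-space structure. *)
Definition plane (R : realType) := convex_lmodType (R^o * R^o)%type.

Definition closed_half_plane (R : realType) : set (plane R) :=
  [set p | 0 <= p.2].

Definition cost (R : realType) (a b c : R) (p : plane R) (s : R) : R :=
  (- p.1 + b * s + c) ^+ 2 / (4 * (1 + a * s)) + (p.2 + s) ^+ 2 / 4.

(* The minimum over s >= 0 is written as an infimum; the lemma Phi_min below
   shows that it is attained at every point of the closed half-plane. *)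
Definition Phi (R : realType) (a b c : R) (p : plane R) : R :=
  inf [set cost a b c p s | s in [set s | 0 <= s]].

Definition Omega (R : realType) (a b c : R) : set (plane R) :=
  [set p | closed_half_plane p /\ Phi a b c p < 1].

Definition level_curve (R : realType) (a b c : R) : set (plane R) :=
  [set p | closed_half_plane p /\ Phi a b c p = 1].

Definition segment (R : realType) (p q : plane R) : set (plane R) :=
  [set p <| t |> q | t in [set: {i01 R}]].

Definition Omega_strictly_convex (R : realType) (a b c : R) : Prop :=
  convex_set (Omega a b c) /\
  ~ (exists p q : plane R, p <> q /\ segment p q `<=` level_curve a b c).

Lemma Phi_min (R : realType) (a b c : R) (p : plane R) :
  0 < a -> closed_half_plane p ->
  exists2 s, 0 <= s & Phi a b c p = cost a b c p s /\
                      forall t, 0 <= t -> Phi a b c p <= cost a b c p t.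
Proof.
rewrite /closed_half_plane /= => a0 y0.
have den0 s : 0 <= s -> 0 < 4 * (1 + a * s).
  by move=> s0; have := mulr_ge0 (ltW a0) s0; lra.
have cge s : 0 <= s -> s ^+ 2 / 4 <= cost a b c p s.
  move=> s0; rewrite /cost.
  have h1 : 0 <= (- p.1 + b * s + c) ^+ 2 / (4 * (1 + a * s)).
    by rewrite divr_ge0 ?sqr_ge0 ?ltW ?den0.
  by have h2 : s ^+ 2 <= (p.2 + s) ^+ 2; [rewrite ler_sqr ?nnegrE; lra | lra].
have c0 := cge 0 (lexx 0).
pose M := 1 + 4 * cost a b c p 0.
have M0 : 0 <= M by rewrite /M; lra.
have ccont : {within `[0, M], continuous (cost a b c p)}.
  apply: continuous_in_subspaceT => s; rewrite inE /= in_itv /= => /andP[s0 _].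
  rewrite /cost; apply: cvgD.
    apply: cvgM.
      apply: (@continuous_comp _ _ _ (fun s => - p.1 + b * s + c)
                (fun x => x ^+ 2)); last exact: exprn_continuous.
      apply: cvgD; last exact: cvg_cst.
      by apply: cvgD; [exact: cvg_cst | apply: cvgM; [exact: cvg_cst|exact: cvg_id]].
    apply: cvgV; first by rewrite gt_eqF ?den0.
    apply: cvgM; first exact: cvg_cst.
    by apply: cvgD; [exact: cvg_cst | apply: cvgM; [exact: cvg_cst|exact: cvg_id]].
  apply: cvgM; last exact: cvg_cst.
  apply: (@continuous_comp _ _ _ (fun s => p.2 + s) (fun x => x ^+ 2));
    last exact: exprn_continuous.
  by apply: cvgD; [exact: cvg_cst | exact: cvg_id].
have [s + smin] := EVT_min M0 ccont.
rewrite in_itv /= => /andP[s0 sM].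
have gmin t : 0 <= t -> cost a b c p s <= cost a b c p t.
  move=> t0; have [tM|Mt] := leP t M; first by apply: smin; rewrite in_itv /= t0.
  have h0 : cost a b c p s <= cost a b c p 0 by apply: smin; rewrite in_itv /= lexx.
  apply: (le_trans h0); apply: le_trans (cge t t0).
  by rewrite /M in Mt; nra.
exists s => //.
have lbP : lbound [set cost a b c p t | t in [set t | 0 <= t]] (cost a b c p s).
  by move=> _ [t /= t0 <-]; exact: gmin.
have -> : Phi a b c p = cost a b c p s.
  apply/eqP; rewrite eq_le; apply/andP; split.
    by apply: ge_inf; [exists (cost a b c p s) | exists s].
  by apply: lb_le_inf => //; exists (cost a b c p s), s.
by split.
Qed.

(* Main.v *)
Require Import Defs.
From mathcomp Require Import all_boot all_order all_algebra.
From mathcomp Require Import all_classical all_reals all_analysis.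
From mathcomp Require Import ring lra.

Import Order.TTheory GRing.Theory Num.Theory.
Local Open Scope classical_set_scope.
Local Open Scope ring_scope.

(** Write p = (x, y), u = - x + b s + c and v = 1 + a s.  Up to the factor 1 / 4,
    [cost] is u ^ 2 / v + (y + s) ^ 2, where u, v, y + s are affine in (p, s)
    and v > 0.  The perspective function u ^ 2 / v is convex, so the cost is
    jointly convex in (p, s), and a minimum over s of a jointly convex function is convex in p.
    This gives the convexity of [Phi], and that of its sublevel set [Omega].

    For the strictness, what the convexity inequality loses can be computed
    exactly ([cost_conv]).  Let p and q lie, with their midpoint, on the level
    curve, and let s and t be minimizers for p and q.  Nothing is lost at the
    midpoint, so y + s and the ratio k = u / v take the same values at (p, s)
    and (q, t); moreover (s + t) / 2 is a minimizer at the midpoint.  If s = t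
    then p = q.  Otherwise, since the cost k ^ 2 v / 4 + (y + s) ^ 2 / 4 is 1 at
    both ends while v = 1 + a s is not the same there, k = 0: the whole
    segment has u = 0 and y + s = 2.  But then the derivative of the cost with
    respect to s is (y + s) / 2 = 1 at the midpoint, where the minimizer
    (s + t) / 2 is positive, and such a minimizer must be stationary
    ([cost_not_min]). *)

(** The defect in the convexity of the perspective function u ^ 2 / v. *)
Lemma sqr_div_conv_gap (F : fieldType) (l m u1 u2 v1 v2 : F) :
  v1 != 0 -> v2 != 0 -> l * v1 + m * v2 != 0 ->
  (l * u1 + m * u2) ^+ 2 / (l * v1 + m * v2) =
  l * (u1 ^+ 2 / v1) + m * (u2 ^+ 2 / v2) -
  l * m * (v1 * v2 / (l * v1 + m * v2) * (u1 / v1 - u2 / v2) ^+ 2).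
Proof. by move=> v1N0 v2N0 vN0; field; rewrite v1N0 v2N0 vN0. Qed.

Section Cost.
Set Implicit Arguments.
Unset Strict Implicit.
Variables (R : realType) (a b c : R).
Hypothesis a_gt0 : 0 < a.
Local Open Scope convex_scope.
Implicit Types (p q : plane R) (s : R).

Let u p s : R := - p.1 + b * s + c.
Let v s : R := 1 + a * s.

Lemma v_gt0 s : 0 <= s -> 0 < v s.
Proof. by move=> s0; have := mulr_ge0 (ltW a_gt0) s0; rewrite /v; lra. Qed.

Lemma costE p s : cost a b c p s = (u p s ^+ 2 / v s + (p.2 + s) ^+ 2) / 4.
Proof. by rewrite /cost /u /v invfM; ring. Qed.

Lemma plane_conv1 (t : {i01 R}) p q :
  (p <| t |> q).1 = t%:num * p.1 + (1 - t%:num) * q.1.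
Proof. by []. Qed.

Lemma plane_conv2 (t : {i01 R}) p q :
  (p <| t |> q).2 = t%:num * p.2 + (1 - t%:num) * q.2.
Proof. by []. Qed.

Lemma conv_ge0 (t : {i01 R}) (x y : R) :
  0 <= x -> 0 <= y -> 0 <= t%:num * x + (1 - t%:num) * y.
Proof.
by move=> x0 y0; rewrite addr_ge0// mulr_ge0// subr_ge0.
Qed.

Lemma half_plane_conv (t : {i01 R}) p q :
  closed_half_plane p -> closed_half_plane q -> closed_half_plane (p <| t |> q).
Proof. by rewrite /closed_half_plane /= => p0 q0; exact: conv_ge0. Qed.

Let gap p q s1 s2 w : R :=
  v s1 * v s2 / w * (u p s1 / v s1 - u q s2 / v s2) ^+ 2
  + (p.2 + s1 - (q.2 + s2)) ^+ 2.

(** The defect in the joint convexity of the cost.  The two squares in [gap]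
    are what the equality case of the convexity inequality kills. *)
Lemma cost_conv (t : {i01 R}) p q s1 s2 : 0 <= s1 -> 0 <= s2 ->
  let s := t%:num * s1 + (1 - t%:num) * s2 in
  cost a b c (p <| t |> q) s =
  t%:num * cost a b c p s1 + (1 - t%:num) * cost a b c q s2
  - t%:num * (1 - t%:num) * gap p q s1 s2 (v s) / 4.
Proof.
move=> s10 s20 s; have s0 : 0 <= s by exact: conv_ge0.
have vE : v s = t%:num * v s1 + (1 - t%:num) * v s2 by rewrite /v /s; ring.
have uE : u (p <| t |> q) s = t%:num * u p s1 + (1 - t%:num) * u q s2.
  by rewrite /u /s plane_conv1; ring.
have yE : (p <| t |> q).2 + s =
    t%:num * (p.2 + s1) + (1 - t%:num) * (q.2 + s2).
  by rewrite plane_conv2 /s; ring.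
rewrite !costE uE yE {1}vE sqr_div_conv_gap -?vE ?gt_eqF ?v_gt0// /gap.
move: (t%:num) (u p s1 / _ - _) => l d.
by lra.
Qed.

Lemma gap_ge0 p q s1 s2 s : 0 <= s1 -> 0 <= s2 -> 0 <= s ->
  0 <= gap p q s1 s2 (v s).
Proof.
move=> s10 s20 s0.
have w0 : 0 < v s1 * v s2 / v s by rewrite divr_gt0 ?mulr_gt0 ?v_gt0.
by rewrite addr_ge0 ?sqr_ge0// mulr_ge0 ?sqr_ge0// ltW.
Qed.

Lemma gap_le0_eq p q s1 s2 s : 0 <= s1 -> 0 <= s2 -> 0 <= s ->
  gap p q s1 s2 (v s) <= 0 ->
  u p s1 / v s1 = u q s2 / v s2 /\ p.2 + s1 = q.2 + s2.
Proof.
move=> s10 s20 s0 gap0.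
have w0 : 0 < v s1 * v s2 / v s by rewrite divr_gt0 ?mulr_gt0 ?v_gt0.
have : gap p q s1 s2 (v s) == 0 by rewrite eq_le gap0 gap_ge0.
rewrite /gap paddr_eq0 ?sqr_ge0 ?(mulr_ge0 (ltW w0)) ?sqr_ge0//.
by rewrite mulf_eq0 (gt_eqF w0) !sqrf_eq0 !subr_eq0 => /andP[/eqP-> /eqP->].
Qed.

(** Where u vanishes the first term of the cost is of second order in s, so
    that moving s down to decrease (y + s) ^ 2 is profitable. *)
Lemma cost_not_min p s : 0 < s -> u p s = 0 -> 0 < p.2 + s ->
  exists2 s', 0 <= s' & cost a b c p s' < cost a b c p s.
Proof.
move=> s0 us Y0; set Y := p.2 + s in Y0.
have b0 : 0 < b ^+ 2 + 1 by have := sqr_ge0 b; lra.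
(* For 4 times the cost, the step from s to s - e adds at most
   (b ^ 2 + 1) e ^ 2 and subtracts 2 Y e. *)
pose e := Num.min s (Y / (b ^+ 2 + 1)).
have e0 : 0 < e by rewrite lt_min s0 divr_gt0.
have es : e <= s by rewrite ge_min lexx.
have eY : e * (b ^+ 2 + 1) <= Y by rewrite -ler_pdivlMr// ge_min lexx orbT.
exists (s - e); first by rewrite subr_ge0.
have se : 0 <= s - e by rewrite subr_ge0.
rewrite !costE us expr0n /= mul0r add0r ltr_pM2r ?invr_gt0//.
have -> : u p (s - e) = - (b * e) by move: us; rewrite /u; lra.
have le : (- (b * e)) ^+ 2 / v (s - e) <= (b * e) ^+ 2.
  rewrite sqrrN ler_pdivrMr ?v_gt0// ler_peMr ?sqr_ge0//.
  by rewrite /v lerDl mulr_ge0// ltW.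
have -> : p.2 + (s - e) = Y - e by rewrite /Y; ring.
have eeY := ler_wpM2l (ltW e0) eY.
have eY0 := mulr_gt0 e0 Y0.
rewrite -/Y; apply: le_lt_trans (_ : (b * e) ^+ 2 + (Y - e) ^+ 2 < _).
  by rewrite lerD2r.
by lra.
Qed.

Lemma Phi_conv (t : {i01 R}) p q :
  closed_half_plane p -> closed_half_plane q ->
  Phi a b c (p <| t |> q)
    <= t%:num * Phi a b c p + (1 - t%:num) * Phi a b c q.
Proof.
move=> p0 q0.
have [s1 s10 [-> _]] := Phi_min b c a_gt0 p0.
have [s2 s20 [-> _]] := Phi_min b c a_gt0 q0.
have [_ _ [_ min_pq]] := Phi_min b c a_gt0 (half_plane_conv t p0 q0).
have s0 := conv_ge0 t s10 s20.
apply: le_trans (min_pq _ s0) _; rewrite cost_conv// gerBl.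
by rewrite divr_ge0// mulr_ge0 ?gap_ge0// mulr_ge0// subr_ge0.
Qed.

Lemma Omega_convex : convex_set (Omega a b c).
Proof.
apply/convex_setW => p q; rewrite !inE => -[p0 p1] [q0 q1] t t0 t1.
rewrite inE; split; first exact: half_plane_conv.
apply: le_lt_trans (Phi_conv t p0 q0) _.
rewrite [ltRHS](_ : _ = t%:num * 1 + (1 - t%:num) * 1); last by ring.
by rewrite ltrD// ltr_pM2l// subr_gt0.
Qed.

Lemma half_ge0 : 0 <= 2^-1 :> R. Proof. by lra. Qed.
Lemma half_le1 : 2^-1 <= 1 :> R. Proof. by lra. Qed.
Definition half : {i01 R} := Itv01 half_ge0 half_le1.

(** The minimal cost is 1 at both ends and at the midpoint, so there is no gap.
    Unless p = q, this forces u = 0 at the midpoint, at a minimizer s > 0,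
    against [cost_not_min]. *)
Lemma level_curve_midpoint p q :
  level_curve a b c p -> level_curve a b c q ->
  level_curve a b c (p <| half |> q) -> p = q.
Proof.
move=> [p0 p1] [q0 q1] [m0 m1].
have [s1 s10 [Ep _]] := Phi_min b c a_gt0 p0.
have [s2 s20 [Eq _]] := Phi_min b c a_gt0 q0.
have [_ _ [_ min_m]] := Phi_min b c a_gt0 m0.
have sm0 := conv_ge0 half s10 s20.
have cm := cost_conv half p q s10 s20.
move: cm sm0; rewrite /= -Ep -Eq p1 q1.
have -> : 1 - 2^-1 = 2^-1 :> R by lra.
set sm := 2^-1 * s1 + 2^-1 * s2 => cm sm0.
have gap0 : gap p q s1 s2 (v sm) <= 0.
  by have := min_m _ sm0; rewrite m1 cm; lra.
have [uv ys] := gap_le0_eq s10 s20 sm0 gap0.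
have v1 := v_gt0 s10; have v2 := v_gt0 s20.
have [s12|s12] := eqVneq s1 s2.
  move: uv ys; rewrite s12 => /(mulIf (invr_neq0 (lt0r_neq0 v2))).
  rewrite /u => u12 /addIr y12.
  case: p q u12 y12 {p0 q0 m0 p1 q1 m1 Ep Eq min_m cm gap0}
    => [x1 y1] [x2 y2] /= u12 ->.
  by congr (_, _); lra.
have [k [u1 u2]] : exists k : R, u p s1 = k * v s1 /\ u q s2 = k * v s2.
  by exists (u q s2 / v s2); rewrite -{1}uv !divfK ?gt_eqF.
have sqrK (x w : R) : 0 < w -> (x * w) ^+ 2 / w = x ^+ 2 * w.
  by move=> w0; field; rewrite gt_eqF.
move: Ep Eq; rewrite !costE u1 u2 ys !sqrK// p1 q1 => E1 E2.
(* The costs k ^ 2 v / 4 + (y + s) ^ 2 / 4 agree while v s1 and v s2 differ. *)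
have /eqP : k ^+ 2 * (a * (s1 - s2)) = 0 by move: E1 E2; rewrite /v; lra.
rewrite !mulf_eq0 subr_eq0 (negbTE s12) (gt_eqF a_gt0) !orbF orbb => /eqP k0.
rewrite k0 !mul0r in u1 u2.
have sm_gt0 : 0 < sm.
  by case: (ltgtP s1 s2) s12 => // s12 _; rewrite /sm; lra.
have Ym_gt0 : 0 < (p <| half |> q).2 + sm.
  by move: m0; rewrite /closed_half_plane /= => m0; rewrite ltr_wpDl.
have um : u (p <| half |> q) sm = 0.
  by move: u1 u2; rewrite /u plane_conv1 /sm /=; lra.
have [s' s'0] := cost_not_min sm_gt0 um Ym_gt0.
rewrite ltNge => /negP[].
apply: le_trans (min_m _ s'0); rewrite cm m1.
by have := gap_ge0 p q s10 s20 sm0; lra.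
Qed.

End Cost.

Theorem proposition3 (R : realType) (a b c : R)
    (a_gt0 : 0 < a) (b_gt0 : 0 < b) (c_gt0 : 0 < c) :
  convex_function (@closed_half_plane R) (Phi a b c) /\
  Omega_strictly_convex a b c.
Proof.
split; first by move=> t p q; rewrite !inE; exact: Phi_conv.
split; first exact: Omega_convex.
move=> [p [q [pq seg]]]; apply: pq; apply: (level_curve_midpoint a_gt0).
- by apply: seg; exists 1%:i01 => //; rewrite conv1.
- by apply: seg; exists 0%:i01 => //; rewrite conv0.
- by apply: seg; exists (half R).
Qed.
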